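(* For each non-negative integer $n$, \[ 2^n\sum_{k=0}^n (-1)^{k} \binom {n+k}{k} F_{2(n+1)+3k} = 1 - \sum_{k=0}^{n-1} (-2)^{k} \binom {2k+1}{k} L_{5k+8}, \] \[ 2^n \sum_{k=0}^n (-1)^{k} \binom {n+k}{k} L_{2(n+1)+3k} = 3 - 5 \sum_{k=0}^{n-1} (-2)^{k} \binom {2k+1}{k} F_{5k+8}. \]
   Context: $F_j$ and $L_j$ denote the Fibonacci and Lucas numbers: $F_0=0,F_1=1$, $L_0=2,L_1=1$, both satisfying $X_j=X_{j-1}+X_{j-2}$. *)

(* Defs.v *)
From mathcomp Require Import all_boot all_order all_algebra.

Set Implicit Arguments.
Unset Strict Implicit.
Unset Printing Implicit Defensive.

Fixpoint fib (j : nat) : nat :=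
  match j with
  | 0 => 0
  | 1 => 1
  | (i.+1 as i1).+1 => fib i1 + fib i
  end.

Fixpoint lucas (j : nat) : nat :=
  match j with
  | 0 => 2
  | 1 => 1
  | (i.+1 as i1).+1 => lucas i1 + lucas i
  end.

(* Main.v *)
Require Import Defs.
From mathcomp Require Import all_boot all_order all_algebra.
From mathcomp Require Import zify ring.
Import GRing.Theory.
Local Open Scope ring_scope.

(** Let G satisfy the Fibonacci recurrence and put
    U(n, m) = \sum_(k <= n) (-1)^k C(n + k, k) G(m + 3k).  Pascal's rule gives
    U(n+1, m) + U(n+1, m+3)
      = U(n, m) - (-1)^n C(2n+1, n) (G(m+3n+3) + 2 G(m+3n+6)),
    and G(j) + G(j+3) = 2 G(j+2) turns the left-hand side into 2 U(n+1, m+2).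
    Taking m = 2(n+1), the quantity 2^n U(n, 2(n+1)) telescopes in n; the two
    identities are the cases G = F and G = L, where G(j) + 2 G(j+3) is
    L(j+3) and 5 F(j+3) respectively. *)

(** Induction on [N]: Pascal's rule splits ['C(m.+1 + N, N)] off the new coefficient, and by the
    alternating sign this part cancels the previous boundary term. *)
Lemma sum_signed_bin_pascal (R : comPzRingType) (g : nat -> R) (m N : nat) :
  \sum_(0 <= k < N.+1) (-1) ^+ k * ('C(m.+1 + k, k))%:R * (g k + g k.+1)
  = \sum_(0 <= k < N.+1) (-1) ^+ k * ('C(m + k, k))%:R * g k
    + (-1) ^+ N * ('C(m.+1 + N, N))%:R * g N.+1.
Proof.
elim: N => [|N IHN].
  by rewrite !big_nat1 !bin0; ring.
rewrite big_nat_recr //= IHN [in RHS]big_nat_recr //=.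
have -> : 'C(m.+1 + N.+1, N.+1) = ('C(m + N.+1, N.+1) + 'C(m.+1 + N, N))%N.
  by rewrite addSn binS addSnnS.
by rewrite natrD exprS; ring.
Qed.

Lemma bin_central_even (n : nat) :
  'C(n.+1 + n.+1, n.+1) = (2 * 'C(2 * n + 1, n))%N.
Proof.
have -> : (n.+1 + n.+1 = (2 * n + 1).+1)%N by lia.
rewrite binS -(@bin_sub (2 * n + 1) n.+1); last by lia.
have -> : (2 * n + 1 - n.+1 = n)%N by lia.
by rewrite addnn -mul2n.
Qed.

Lemma bin_central_odd (n : nat) : 'C(n + n.+1, n.+1) = 'C(2 * n + 1, n).
Proof.
rewrite -bin_sub ?leq_addl // addnK.
by congr 'C(_, _); lia.
Qed.

(** The subtracted part collects the term [k = n.+1] and the boundary term; its factor 2 is the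
    ratio of C(2n+2, n+1) to C(2n+1, n). *)
Lemma sum_signed_bin_step (R : comPzRingType) (g : nat -> R) (n : nat) :
  \sum_(0 <= k < n.+2) (-1) ^+ k * ('C(n.+1 + k, k))%:R * (g k + g k.+1)
  = \sum_(0 <= k < n.+1) (-1) ^+ k * ('C(n + k, k))%:R * g k
    - (-1) ^+ n * ('C(2 * n + 1, n))%:R * (g n.+1 + 2 * g n.+2).
Proof.
rewrite sum_signed_bin_pascal big_nat_recr //=.
by rewrite bin_central_even bin_central_odd natrM exprS; ring.
Qed.

Lemma fibonacci_like_telescope (R : comPzRingType) (G : nat -> R) (n : nat) :
  (forall j, G j.+2 = G j.+1 + G j) ->
  2 ^+ n * \sum_(0 <= k < n.+1)
      (-1) ^+ k * ('C(n + k, k))%:R * G (2 * (n + 1) + 3 * k)%N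
  = G 2 - \sum_(0 <= k < n) (-2) ^+ k * ('C(2 * k + 1, k))%:R
            * (G (5 * k + 5)%N + 2 * G (5 * k + 8)%N).
Proof.
move=> recG; elim: n => [|n IHn].
  by rewrite big_nat1 big_geq // bin0; ring.
(* One factor 2 of [2 ^+ n.+1] is spent here to give each summand the form [g k + g k.+1]. *)
have halve k : 2 * G (2 * (n.+1 + 1) + 3 * k)%N
    = G (2 * (n + 1) + 3 * k)%N + G (2 * (n + 1) + 3 * k.+1)%N.
  have -> : (2 * (n.+1 + 1) + 3 * k = (2 * (n + 1) + 3 * k).+2)%N by lia.
  have -> : (2 * (n + 1) + 3 * k.+1 = (2 * (n + 1) + 3 * k).+3)%N by lia.
  by rewrite !recG; ring.
rewrite [in RHS]big_nat_recr //= opprD addrA -IHn exprSr -mulrA big_distrr /=.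
under eq_bigr => k _ do rewrite mulrCA halve.
rewrite (sum_signed_bin_step _ (fun k => G (2 * (n + 1) + 3 * k)%N)).
have -> : (2 * (n + 1) + 3 * n.+1 = 5 * n + 5)%N by lia.
have -> : (2 * (n + 1) + 3 * n.+2 = 5 * n + 8)%N by lia.
by rewrite (exprNn 2 n); ring.
Qed.

Lemma fib_lucas_shift3 (j : nat) :
  (fib j + 2 * fib j.+3 = lucas j.+3)%N
  /\ (lucas j + 2 * lucas j.+3 = 5 * fib j.+3)%N.
Proof.
(* Both Lucas values become linear in [fib j] and [fib j.+1]; the additive form avoids truncated
   subtraction. *)
suff : lucas j.+1 = (2 * fib j + fib j.+1)%N
    /\ (lucas j + fib j = 2 * fib j.+1)%N.
  by case=> /= ? ?; lia.
elim: j => [|j [IH1 IH2]] //.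
by move: IH1 IH2 => /= *; lia.
Qed.

Theorem theorem19 (n : nat) :
  (2 ^+ n * \sum_(0 <= k < n.+1)
       (-1) ^+ k * ('C(n + k, k))%:Z * (fib (2 * (n + 1) + 3 * k))%:Z
   = 1 - \sum_(0 <= k < n)
       (-2) ^+ k * ('C(2 * k + 1, k))%:Z * (lucas (5 * k + 8))%:Z :> int)
  /\
  (2 ^+ n * \sum_(0 <= k < n.+1)
       (-1) ^+ k * ('C(n + k, k))%:Z * (lucas (2 * (n + 1) + 3 * k))%:Z
   = 3 - 5 * \sum_(0 <= k < n)
       (-2) ^+ k * ('C(2 * k + 1, k))%:Z * (fib (5 * k + 8))%:Z :> int).
Proof.
have shift k : (5 * k + 8 = (5 * k + 5).+3)%N by lia.
split.
- under eq_bigr => k _ do rewrite -natz.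
  rewrite (fibonacci_like_telescope int (fun j => (fib j)%:Z)) //.
  (* The constant 1 is [fib 2]; in the Lucas case, 3 is [lucas 2]. *)
  congr (_ - _); apply: eq_bigr => k _.
  rewrite (natz 'C(_, _)) shift; congr (_ * _).
  by have [+ _] := fib_lucas_shift3 (5 * k + 5); lia.
- under eq_bigr => k _ do rewrite -natz.
  rewrite (fibonacci_like_telescope int (fun j => (lucas j)%:Z)) //.
  rewrite big_distrr /=; congr (_ - _); apply: eq_bigr => k _.
  rewrite (natz 'C(_, _)) shift [RHS]mulrCA; congr (_ * _).
  by have [_] := fib_lucas_shift3 (5 * k + 5); lia.
Qed.
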